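(* For all integers $n \geq 1$, $$p_{1,1}(n) \equiv \begin{cases} 1 \pmod{2}, & \text{if } n = k(3k+1) \text{ or } n = k(3k-1) \text{ for some integer } k, \\ 0 \pmod{2}, & \text{otherwise.} \end{cases}$$
   Context: For positive integers $A, a$ and an integer partition $\lambda$, $\mathrm{mex}_{A,a}(\lambda)$ denotes the smallest positive integer congruent to $a$ modulo $A$ that is not a part of $\lambda$. For $n \geq 0$, $p_{A,a}(n)$ denotes the number of partitions $\lambda$ of $n$ satisfying $\mathrm{mex}_{A,a}(\lambda) \equiv a \pmod{2A}$. In particular, $p_{1,1}(n)$ is the number of partitions $\lambda$ of $n$ whose smallest positive integer that is not a part is odd. *)

(* Defs.v *)
From HB Require Import structures.
From mathcomp Require Import all_boot.

Set Implicit Arguments.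
Unset Strict Implicit.
Unset Printing Implicit Defensive.

Definition is_intpart (n : nat) (s : seq nat) : bool :=
  [&& sorted geq s, all (leq 1) s & sumn s == n].

Record intpart (n : nat) : Type :=
  IntPart { parts :> seq nat; intpartP : is_intpart n parts }.

HB.instance Definition _ n := [isSub for @parts n].
HB.instance Definition _ n := [Countable of intpart n by <:].

(* A partition of n has at most n parts, all at most n. *)

Lemma mem_leq_sumn (s : seq nat) (i : nat) : i \in s -> i <= sumn s.
Proof.
elim: s => //= j s IHs; rewrite inE => /predU1P[->|/IHs le_is].
  exact: leq_addr.
exact: leq_trans le_is (leq_addl _ _).
Qed.

Lemma size_leq_sumn (s : seq nat) : all (leq 1) s -> size s <= sumn s.
Proof. by elim: s => //= j s IHs /andP[j_gt0 /IHs]; exact: (leq_add j_gt0). Qed.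

Fact intpart_size n (la : intpart n) : size (map (@inord n) la) <= n.
Proof.
have /and3P[_ pos /eqP sum_la] := intpartP la.
by rewrite size_map -[leqRHS]sum_la size_leq_sumn.
Qed.

Definition bseq_of_intpart n (la : intpart n) : n.-bseq 'I_n.+1 :=
  Bseq (intpart_size la).

Definition intpart_of_bseq n (t : n.-bseq 'I_n.+1) : option (intpart n) :=
  insub (map val t).

Fact bseq_of_intpartK n : pcancel (@bseq_of_intpart n) (@intpart_of_bseq n).
Proof.
move=> la; rewrite /intpart_of_bseq /=.
suff -> : map val (map (@inord n) la) = la by exact: valK.
have /and3P[_ _ /eqP sum_la] := intpartP la.
rewrite -map_comp map_id_in // => i /mem_leq_sumn; rewrite sum_la => le_in.
by rewrite /= inordK.
Qed.

HB.instance Definition _ n : isFinite (intpart n) :=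
  PCanIsFinite (@bseq_of_intpartK n).

Definition mex_candidate (A a : nat) (s : seq nat) (m : nat) : bool :=
  [&& 0 < m, m == a %[mod A] & m \notin s].

Fact mex_exists (A a : nat) (s : seq nat) :
  exists m, (0 < A) ==> mex_candidate A a s m.
Proof.
exists ((sumn s).+1 * A + a); apply/implyP=> A_gt0; apply/and3P; split.
- by rewrite addn_gt0 muln_gt0 A_gt0.
- by rewrite modnMDl.
- apply/negP=> /mem_leq_sumn; rewrite leqNgt => /negP; apply.
  exact: leq_trans (leq_pmulr _ A_gt0) (leq_addr _ _).
Qed.

(* The guard 0 < A only makes the function total: for A = 0 there may be no
   candidate, and the value is then the junk value 0. *)
Definition mex (A a : nat) (s : seq nat) : nat := ex_minn (mex_exists A a s).

Lemma mexP (A a : nat) (s : seq nat) : 0 < A ->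
  mex_candidate A a s (mex A a s)
  /\ (forall m, mex_candidate A a s m -> mex A a s <= m).
Proof.
move=> A_gt0; rewrite /mex; case: ex_minnP => m; rewrite A_gt0 /= => Hm min_m.
by split=> // m' Hm'; apply: min_m.
Qed.

Definition pmex (A a n : nat) : nat :=
  #|[set la : intpart n | mex A a la == a %[mod 2 * A]]|.

(* Main.v *)
Require Import Defs.
From mathcomp Require Import all_boot all_algebra.
From mathcomp Require Import zify ring.
Set Implicit Arguments.
Unset Strict Implicit.
Unset Printing Implicit Defensive.
Import GRing.Theory.
Local Open Scope ring_scope.

(** Modulo 2, the indicator of an odd mex is the mex itself, and the mex of a
partition la is the number of k >= 0 such that 1, ..., k all occur in la
([mex_sum]).  Hence p_{1,1}(n) is, modulo 2, the sum over k of the number of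
partitions of n that contain 1, ..., k.  Write f for the product of the
1 - q^i.  Partitions that contain 1, ..., k have generating function
q^(k(k+1)/2) / f, as an obligatory part i replaces the geometric series of the
q^(i m), m >= 0, by the same series without its first term
([initial_part_gfM]).  So p_{1,1} has generating function C = psi / f modulo 2,
where psi is the sum of the q^(k(k+1)/2).

Let E be the product of the 1 - q^(2i) and O that of the 1 - q^(2i-1), so that
f = O E.  Gauss's identity says O psi = E ([triangular_trunc]).  Therefore
f^2 C = f psi = E O psi = E^2, and in characteristic 2 the Frobenius
endomorphism gives E = f^2 ([prod_even_F2]), so C = E
([sum_initial_part_gf]).  Finally Euler's pentagonal number theorem, with q^2
in place of q, expands E modulo 2 as 1 plus the sum over s >= 1 of
q^(s(3s-1)) + q^(s(3s+1)); these exponents are pairwise distinct.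

The identities of Gauss and Euler come from finite identities due to Shanks
([shanks_triangular], [shanks_pentagonal]), proved by induction on the
truncation order through a telescoping sum.  Power series are handled as
polynomials whose coefficients are compared below a fixed degree ([eqXn]). *)

(** * Shanks's finite forms of the identities of Gauss and Euler *)

(** Modulo high powers of q only the term s = 0 survives on the left, which
leaves Gauss's identity for the sum of the q^(s(s+1)/2).  The quotients of
products in Shanks's formula are written as products over s < i <= n, and the
denominators are multiplied out. *)
Lemma shanks_triangular (R : comPzRingType) (q : R) (n : nat) :
  \sum_(0 <= s < n.+1) (\prod_(s.+1 <= i < n.+1) (1 - q ^+ (2 * i)))
      * (\prod_(0 <= i < s) (1 - q ^+ (2 * i).+1)) * q ^+ (s * (2 * n).+1)
  = (\prod_(0 <= i < n) (1 - q ^+ (2 * i).+1))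
      * \sum_(0 <= s < (2 * n).+1) q ^+ 'C(s.+1, 2).
Proof.
elim: n => [|n IHn].
  by rewrite !big_nat1 !big_geq // mul0n bin_small // !mulr1.
pose E s m := \prod_(s <= i < m) (1 - q ^+ (2 * i)).
pose O s := \prod_(0 <= i < s) (1 - q ^+ (2 * i).+1).
have OS s : O s.+1 = O s * (1 - q ^+ (2 * s).+1) by rewrite /O big_nat_recr.
have EE s : E s s = 1 by rewrite /E big_geq.
rewrite big_nat_recr //= -/(O _) -/(E _ _) EE mul1r.
have -> : (2 * n.+1).+1 = (2 * n).+3 by lia.
rewrite -[in RHS]/(O n.+1) [in RHS]big_nat_recr //= [in RHS]big_nat_recr //= !mulrDr.
have -> : 'C((2 * n).+3, 2) = (n.+1 * (2 * n).+3)%N by rewrite bin2; lia.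
congr (_ + _).
rewrite {1}OS [X in X * \sum_(_ <= _ < _) _]mulrC -mulrA -IHn.
(* The left side for n.+1 without its last term, minus 1 - q^(2n+1) times the
   left side for n, telescopes: its s-th term is v s.+1 - v s, and v 0 vanishes
   by the factor of index 0 in E. *)
pose v s := E s n.+1 * O s * q ^+ (s * (2 * n).+1).
have -> : O n.+1 * q ^+ 'C((2 * n).+2, 2) = v n.+1 - v 0%N.
  rewrite /v EE /E big_nat_recl // muln0 expr0 subrr !mul0r subr0 mul1r.
  by congr (_ * q ^+ _); rewrite bin2; lia.
rewrite -telescope_sumr // mulr_sumr -big_split /=.
apply: eq_big_nat => s /andP[_ lesn].
rewrite /v -/(E _ _) -/(O _) -[\prod_(s.+1 <= i < n.+1) _]/(E s.+1 n.+1).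
have -> : E s.+1 n.+2 = E s.+1 n.+1 * (1 - q ^+ (2 * n.+1)).
  by rewrite /E big_nat_recr.
have -> : E s n.+1 = (1 - q ^+ (2 * s)) * E s.+1 n.+1.
  by rewrite /E big_ltn.
rewrite OS.
have -> : q ^+ (s * (2 * n).+3) = q ^+ (s * (2 * n).+1) * (q ^+ (2 * s)).
  by rewrite -exprD; congr (_ ^+ _); lia.
have -> : q ^+ (s.+1 * (2 * n).+1) = q ^+ (s * (2 * n).+1) * (q ^+ (2 * n).+1).
  by rewrite -exprD; congr (_ ^+ _); lia.
have -> : q ^+ (2 * n.+1) = q ^+ (2 * n).+1 * q by rewrite -exprSr mulnS.
rewrite [q ^+ (2 * s).+1]exprSr.
ring.
Qed.

(** Modulo high powers of q only the term s = 0 survives on the left, which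
leaves Euler's pentagonal number theorem. *)
Lemma shanks_pentagonal (R : comPzRingType) (q : R) (n : nat) :
  \sum_(0 <= s < n.+1) (-1) ^+ s * (\prod_(s.+1 <= i < n.+1) (1 - q ^+ i))
      * q ^+ (s * n + 'C(s.+1, 2))
  = 1 + \sum_(1 <= s < n.+1)
          (-1) ^+ s * (q ^+ (s * s + 'C(s, 2)) + q ^+ (s * s + 'C(s.+1, 2))).
Proof.
elim: n => [|n IHn].
  by rewrite big_nat1 !big_geq // mul0n bin_small // !mulr1 addr0.
pose P s m := \prod_(s <= i < m) (1 - q ^+ i).
have PE s : P s s = 1 by rewrite /P big_geq.
rewrite big_nat_recr //= -/(P _ _) PE mulr1.
rewrite [in RHS]big_nat_recr //= [in RHS]addrA -IHn mulrDr [in RHS]addrA.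
congr (_ + _).
(* The left side for n.+1 without its last term, minus the left side for n,
   telescopes: its s-th term is v s - v s.+1, and v 0 vanishes by the factor of
   index 0 in P. *)
pose v s := - (-1) ^+ s * P s n.+1 * q ^+ (s * n + 'C(s.+1, 2)).
have -> : (-1) ^+ n.+1 * q ^+ (n.+1 * n.+1 + 'C(n.+1, 2)) = v 0%N - v n.+1.
  rewrite /v PE {1}/P big_nat_recl // expr0 subrr mul0r mulr0 mul0r sub0r.
  rewrite mulr1 mulNr opprK.
  by congr (_ * q ^+ _); rewrite !binS !bin1 bin0; lia.
rewrite -[v 0%N - _]opprB -telescope_sumr // -sumrN -big_split /=.
apply: eq_big_nat => s /andP[_ lesn].
rewrite /v -/(P _ _) -[\prod_(s.+1 <= i < n.+1) _]/(P s.+1 n.+1).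
have -> : P s.+1 n.+2 = P s.+1 n.+1 * (1 - q ^+ n.+1).
  by rewrite /P big_nat_recr.
have -> : P s n.+1 = (1 - q ^+ s) * P s.+1 n.+1.
  by rewrite /P big_ltn.
have -> : q ^+ (s * n.+1 + 'C(s.+1, 2))
    = q ^+ (s * n + 'C(s.+1, 2)) * q ^+ s.
  by rewrite -exprD; congr (_ ^+ _); lia.
have -> : q ^+ (s.+1 * n + 'C(s.+2, 2))
    = q ^+ (s * n + 'C(s.+1, 2)) * q ^+ n.+1 * q ^+ s.
  by rewrite -!exprD; congr (_ ^+ _); rewrite !binS !bin1 bin0; lia.
rewrite [(-1) ^+ s.+1]exprS.
ring.
Qed.

(** * Polynomials up to a given degree *)

Definition eqXn (R : nzRingType) (n : nat) (p q : {poly R}) : Prop :=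
  forall i, (i < n)%N -> p`_i = q`_i.

Lemma eqXn_sym (R : nzRingType) n (p q : {poly R}) : eqXn n p q -> eqXn n q p.
Proof. by move=> pq i /pq. Qed.

Lemma eqXn_trans (R : nzRingType) n (q p r : {poly R}) :
  eqXn n p q -> eqXn n q r -> eqXn n p r.
Proof. by move=> pq qr i lt_in; rewrite pq ?qr. Qed.

Lemma eqXnD (R : nzRingType) n (p p' q q' : {poly R}) :
  eqXn n p p' -> eqXn n q q' -> eqXn n (p + q) (p' + q').
Proof. by move=> pp qq i lt_in; rewrite !coefD pp ?qq. Qed.

Lemma eqXnM (R : nzRingType) n (p p' q q' : {poly R}) :
  eqXn n p p' -> eqXn n q q' -> eqXn n (p * q) (p' * q').
Proof.
move=> pp qq i lt_in; rewrite !coefM; apply: eq_bigr => j _.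
by rewrite pp ?qq //; apply: leq_ltn_trans lt_in; rewrite ?leq_subr -1?ltnS.
Qed.

Lemma eqXn_prod (R : nzRingType) n (I : eqType) (r : seq I) (F G : I -> {poly R}) :
  {in r, forall i, eqXn n (F i) (G i)} ->
  eqXn n (\prod_(i <- r) F i) (\prod_(i <- r) G i).
Proof.
move=> FG; rewrite big_seq [X in eqXn _ _ X]big_seq.
by elim/big_rec2: _ => // i p q /FG; exact: eqXnM.
Qed.

Lemma eqXn_sum (R : nzRingType) n (I : eqType) (r : seq I) (F G : I -> {poly R}) :
  {in r, forall i, eqXn n (F i) (G i)} ->
  eqXn n (\sum_(i <- r) F i) (\sum_(i <- r) G i).
Proof.
move=> FG; rewrite big_seq [X in eqXn _ _ X]big_seq.
by elim/big_rec2: _ => // i p q /FG; exact: eqXnD.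
Qed.

Lemma eqXn_prod1 (R : nzRingType) n (I : eqType) (r : seq I) (F : I -> {poly R}) :
  {in r, forall i, eqXn n (F i) 1} -> eqXn n (\prod_(i <- r) F i) 1.
Proof. by move/eqXn_prod; rewrite big1_eq. Qed.

Lemma eqXn_sum0 (R : nzRingType) n (I : eqType) (r : seq I) (F : I -> {poly R}) :
  {in r, forall i, eqXn n (F i) 0} -> eqXn n (\sum_(i <- r) F i) 0.
Proof. by move/eqXn_sum; rewrite big1_eq. Qed.

Lemma eqXn_mulXn0 (R : nzRingType) n m (p : {poly R}) :
  (n <= m)%N -> eqXn n (p * 'X^m) 0.
Proof. by move=> le_nm i lt_in; rewrite coefMXn coef0 (leq_trans lt_in). Qed.

(** A polynomial of constant term 1 is invertible as a power series. *)
Lemma eqXn_mulI (R : nzRingType) n (p q r : {poly R}) :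
  p`_0 = 1 -> eqXn n (p * q) (p * r) -> eqXn n q r.
Proof.
move=> p0 pqr i; elim/ltn_ind: i => i IHi lt_in.
have := pqr i lt_in; rewrite !coefM !big_ord_recl /= !p0 !mul1r subn0.
rewrite (eq_bigr (fun j : 'I_i => p`_(bump 0 j) * r`_(i - bump 0 j))); last first.
  move=> j _; congr (_ * _); have := ltn_ord j; rewrite /bump add1n => ltji.
  by apply: IHi; lia.
exact: addIr.
Qed.

(** * Generating functions of partitions by multiplicities *)

Lemma sumn_count (s : seq nat) n : all (leq 1) s -> all (geq n) s ->
  sumn s = (\sum_(i < n) i.+1 * count_mem i.+1 s)%N.
Proof.
elim: s => [|x s IHs] /=; first by rewrite big1 // => i _; rewrite muln0.
case/andP=> x_gt0 spos /andP[xn sn]; rewrite IHs //.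
under [RHS]eq_bigr do rewrite mulnDr.
rewrite [RHS]big_split; congr (_ + _)%N.
have xn' : (x.-1 < n)%N by lia.
rewrite (bigD1 (Ordinal xn')) //= big1 ?addn0.
  by rewrite prednK // eqxx muln1.
move=> i; rewrite -val_eqE /= => nix; case: eqP => [xi|]; last by rewrite muln0.
by move: nix; rewrite xi eqxx.
Qed.

Section IntPart.
Variable n : nat.
Implicit Type la : intpart n.

Lemma intpart_gt0 la : all (leq 1) la.
Proof. by have /and3P[] := intpartP la. Qed.

Lemma sumn_intpart la : sumn la = n.
Proof. by have /and3P[_ _ /eqP] := intpartP la. Qed.

Lemma intpart_leq la : all (geq n) la.
Proof. by apply/allP=> i /mem_leq_sumn; rewrite sumn_intpart. Qed.

Lemma sum_mult_intpart la : (\sum_(i < n) i.+1 * count_mem i.+1 la = n)%N.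
Proof. by rewrite -sumn_count ?intpart_gt0 ?intpart_leq // sumn_intpart. Qed.

Lemma mult_intpart_leq la (i : 'I_n) : (count_mem i.+1 la < n.+1)%N.
Proof.
rewrite ltnS -[leqRHS](sum_mult_intpart la) (bigD1 i) //=.
by apply: leq_trans (leq_addr _ _); rewrite leq_pmull.
Qed.

(** Index i stands for the part size i.+1. *)
Definition mult_of_intpart la : {ffun 'I_n -> 'I_n.+1} :=
  [ffun i => Ordinal (mult_intpart_leq la i)].

Lemma mult_of_intpart_inj : injective mult_of_intpart.
Proof.
move=> la mu /ffunP eq_m; apply: val_inj => /=.
have /and3P[la_s _ _] := intpartP la; have /and3P[mu_s _ _] := intpartP mu.
have geqT : transitive geq by move=> a b c ab bc; exact: leq_trans bc ab.
have geqA : antisymmetric geq by move=> a b; rewrite andbC; exact: anti_leq.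
apply: (sorted_eq geqT geqA) => //; apply/allP => /= x x_in; apply/eqP.
have /andP[x_gt0 xn] : (0 < x <= n)%N.
  move: x_in; rewrite mem_cat => /orP[] x_in.
    by apply/andP; split; [exact: (allP (intpart_gt0 la))|exact: (allP (intpart_leq la))].
  by apply/andP; split; [exact: (allP (intpart_gt0 mu))|exact: (allP (intpart_leq mu))].
have xn' : (x.-1 < n)%N by lia.
have /(congr1 val) := eq_m (Ordinal xn').
by rewrite !ffunE /= prednK.
Qed.

Lemma mult_of_intpart_onto (f : {ffun 'I_n -> 'I_n.+1}) :
  (\sum_(i < n) i.+1 * f i)%N = n -> exists la, mult_of_intpart la = f.
Proof.
move=> sumf; pose s := flatten [seq nseq (f i) i.+1 | i <- enum 'I_n].
have counts (i : 'I_n) : count_mem i.+1 s = f i.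
  rewrite /s count_flatten -map_comp sumnE big_map big_enum /=.
  rewrite (bigD1 i) //= big1 ?addn0; first by rewrite count_nseq /= eqxx mul1n.
  by move=> j; rewrite count_nseq /= eqSS -val_eqE => /negPf->.
have mems x : x \in s -> (0 < x <= n)%N.
  case/flatten_mapP=> i _; rewrite mem_nseq => /andP[_ /eqP->].
  exact: ltn_ord.
pose t := sort geq s.
have tP : is_intpart n t.
  apply/and3P; split.
  - by apply: sort_sorted => a b; exact: leq_total.
  - by apply/allP=> x; rewrite mem_sort => /mems/andP[].
  - rewrite (@sumn_count _ n); first last.
    + by apply/allP=> x; rewrite mem_sort => /mems/andP[].
    + by apply/allP=> x; rewrite mem_sort => /mems/andP[].
    apply/eqP; rewrite -[RHS]sumf; apply: eq_bigr => i _.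
    by rewrite count_sort counts.
exists (IntPart tP); apply/ffunP => i; apply: val_inj; rewrite ffunE /=.
by rewrite count_sort counts.
Qed.

(** A partition amounts to the family of its multiplicities, and expanding the
product enumerates these families, each weighted by X to the size of the
partition.  Multiplicities above n cannot occur in a partition of n, so finite
sums replace the geometric series. *)
Lemma card_intpart_mult (R : comNzRingType) (P : nat -> pred nat) :
  #|[set la : intpart n | [forall i : 'I_n, P i.+1 (count_mem i.+1 la)]]|%:R
  = (\prod_(i < n) \sum_(m < n.+1 | P i.+1 m) 'X^(i.+1 * m) : {poly R})`_n.
Proof.
rewrite (bigA_distr_big_dep (fun (i : 'I_n) (m : 'I_n.+1) => P i.+1 m)) /=.
rewrite coef_sum.
under eq_bigr => f _ do rewrite -expr_sum coefXn.
rewrite -natr_sum -big_mkcondr /= sum1_card; congr _%:R.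
rewrite -(card_imset _ mult_of_intpart_inj); apply: eq_card => f.
apply/imsetP/andP => [[la]|[/familyP Pf /eqP sumf]].
  rewrite inE => /forallP Pla ->; split.
    by apply/familyP => i; rewrite ffunE; exact: Pla.
  apply/eqP; rewrite -[LHS](sum_mult_intpart la).
  by apply: eq_bigr => i _; rewrite ffunE.
have [la fla] := mult_of_intpart_onto (esym sumf).
exists la => //; rewrite inE; apply/forallP => i.
by have := Pf i; rewrite -fla ffunE.
Qed.

(** Up to degree n, the generating function of the partitions in which
1, ..., k all occur; its coefficients beyond n have no such meaning. *)
Definition initial_part_gf (R : comNzRingType) k : {poly R} :=
  \prod_(i < n) \sum_(m < n.+1 | (i < k)%N ==> (0 < m)%N) 'X^(i.+1 * m).

Lemma card_initial_parts (R : comNzRingType) k : (k <= n)%N ->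
  #|[set la : intpart n | all (mem (parts la)) (iota 1 k)]|%:R
  = (initial_part_gf R k)`_n.
Proof.
move=> le_kn.
rewrite -(@card_intpart_mult R (fun i m => (i <= k)%N ==> (0 < m)%N)).
congr _%:R; apply: eq_card => la; rewrite !inE.
apply/allP/forallP => [in_la i|in_la x].
  apply/implyP => ik; rewrite -has_count has_pred1; apply: in_la.
  by rewrite mem_iota; lia.
rewrite mem_iota => /andP[x_gt0 xk]; have xn : (x.-1 < n)%N by lia.
have := in_la (Ordinal xn); rewrite /= prednK // -has_count has_pred1.
by move/implyP; apply; lia.
Qed.

(** Multiplying by 1 - X^i collapses the geometric series of the part i to its
first term, which is X^i for an obligatory part and 1 otherwise.  The exponents
add up to 1 + ... + k. *)
Lemma initial_part_gfM (R : comNzRingType) k : (k <= n)%N ->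
  eqXn n.+1 ((\prod_(1 <= i < n.+1) (1 - 'X^i)) * initial_part_gf R k)
    'X^('C(k.+1, 2)).
Proof.
move=> le_kn; rewrite /initial_part_gf big_add1 big_mkord -big_split /=.
have -> : 'X^('C(k.+1, 2)) = \prod_(i < n) 'X^(if (i < k)%N then i.+1 else 0)
    :> {poly R}.
  rewrite -expr_sum -big_mkcond /= -triangular_sum big_nat_recl // add0n.
  by rewrite -(big_ord_widen n S le_kn) big_mkord.
apply: eqXn_prod => i _.
have telescoped m0 : (m0 <= n)%N ->
    eqXn n.+1 ((1 - 'X^(i.+1)) * \sum_(m0 <= m < n.+1) 'X^(i.+1 * m))
      ('X^(i.+1 * m0) : {poly R}).
  move=> m0n.
  have -> : (1 - 'X^(i.+1)) * \sum_(m0 <= m < n.+1) 'X^(i.+1 * m)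
      = 'X^(i.+1 * m0) - 'X^(i.+1 * n.+1) :> {poly R}.
    rewrite -[RHS]opprB -(telescope_sumr (fun m => 'X^(i.+1 * m))); last exact: leqW.
    rewrite -sumrN mulr_sumr; apply: eq_bigr => m _.
    by rewrite mulrBl mul1r opprB mulnS exprD.
  rewrite -[X in eqXn _ _ X]addr0; apply: eqXnD => // j lt_jn.
  rewrite coefN coefXn coef0; case: eqP => [|_]; last by rewrite oppr0.
  by nia.
case: ltnP => ik.
  rewrite big_mkcond /=.
  rewrite -(big_mkord xpredT (fun m => if (0 < m)%N then 'X^(i.+1 * m) else 0)).
  rewrite big_nat_recl // add0r -(big_add1 _ _ 0 n.+1 xpredT (fun m => 'X^(i.+1 * m))).
  by have := telescoped 1%N; rewrite muln1; apply; lia.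
under eq_bigl do rewrite implyFb.
have := telescoped 0%N; rewrite muln0.
by rewrite -(big_mkord xpredT (fun m => 'X^(i.+1 * m))); exact.
Qed.

(** 1, ..., k all occur in la exactly when k < mex la.  The range of k suffices
because n.+1 is not a part of a partition of n. *)
Lemma mex_sum la : mex 1 1 la = (\sum_(k < n.+1) all (mem (parts la)) (iota 1 k))%N.
Proof.
have [/and3P[mex_gt0 _ mexN] mex_min] := @mexP 1 1 la isT.
have mex_in m : (0 < m < mex 1 1 la)%N -> m \in (la : seq nat).
  case/andP=> m_gt0; rewrite ltnNge; apply: contraNT => mN.
  by apply: mex_min; rewrite /mex_candidate m_gt0 !modn1 eqxx.
have le_mex : (mex 1 1 la <= n.+1)%N.
  apply: mex_min; rewrite /mex_candidate !modn1 eqxx /=; apply/negP.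
  by move/(allP (intpart_leq la)) => /=; rewrite ltnn.
rewrite -{1}[mex 1 1 la]card_ord -sum1_card.
rewrite (big_ord_widen n.+1 (fun=> 1%N) le_mex) big_mkcond /=.
apply: eq_bigr => k _; case: ltnP => k_mex.
  suff -> : all (mem (parts la)) (iota 1 k) by [].
  by apply/allP=> m; rewrite mem_iota => mk; apply: mex_in; lia.
suff -> : all (mem (parts la)) (iota 1 k) = false by [].
apply/allP => /(_ (mex 1 1 la)); rewrite mem_iota mex_gt0 add1n ltnS k_mex.
by move/(_ isT) => mex_la; move/negP: mexN; apply.
Qed.

End IntPart.

(** * The generating function modulo 2 *)

Lemma natr_F2 (a : nat) : (a%:R : 'F_2) = (odd a)%:R.
Proof. by apply: val_inj; rewrite /= !val_Fp_nat // !modn2; case: odd. Qed.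

(** Double counting of the pairs (la, k) with k < mex la. *)
Lemma pmex_F2 n : ((pmex 1 1 n)%:R : 'F_2)
  = (\sum_(k < n.+1) initial_part_gf n 'F_2 k)`_n.
Proof.
rewrite coef_sum.
under eq_bigr => k _ do rewrite -(card_initial_parts _ (ltn_ord k : (k <= n)%N)).
rewrite /pmex -sum1_card natr_sum big_mkcond /=.
have -> : \sum_(la : intpart n)
      (if la \in [set mu : intpart n | mex 1 1 mu == 1 %[mod 2 * 1]]
       then 1%:R else 0)
    = \sum_(la : intpart n) (mex 1 1 la)%:R :> 'F_2.
  by apply: eq_bigr => la _; rewrite inE [RHS]natr_F2 muln1 !modn2; case: odd.
under [LHS]eq_bigr => la _ do rewrite (mex_sum la) natr_sum.
rewrite exchange_big /=; apply: eq_bigr => k _.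
rewrite -sum1_card natr_sum [RHS]big_mkcond /=.
by apply: eq_bigr => la _; rewrite inE; case: all.
Qed.

Lemma pchar2_polyF2 : 2 \in [pchar {poly 'F_2}].
Proof. by rewrite pchar_poly pchar_Fp. Qed.

Lemma eqXn_prod1BXn (R : comNzRingType) n m : (n <= m)%N ->
  eqXn n.+1 (\prod_(1 <= i < m.+1) (1 - 'X^i) : {poly R})
    (\prod_(1 <= i < n.+1) (1 - 'X^i)).
Proof.
move=> nm; rewrite (@big_cat_nat _ _ _ n.+1) //=.
rewrite -[X in eqXn _ _ X]mulr1; apply: eqXnM => //.
apply: eqXn_prod1 => i; rewrite mem_index_iota => /andP[ni _].
rewrite -[X in eqXn _ _ X]addr0 -['X^i]mul1r -mulNr; apply: eqXnD => //.
exact: eqXn_mulXn0.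
Qed.

Lemma prod_odd_even (R : comPzRingType) (q : R) n :
  (\prod_(0 <= i < n) (1 - q ^+ (2 * i).+1))
    * (\prod_(1 <= i < n.+1) (1 - q ^+ (2 * i)))
  = \prod_(1 <= i < (2 * n).+1) (1 - q ^+ i).
Proof.
elim: n => [|n IHn]; first by rewrite !big_geq // mulr1.
have -> : (2 * n.+1).+1 = (2 * n).+3 by lia.
rewrite big_nat_recr //= [X in _ * X]big_nat_recr //= [RHS]big_nat_recr //=.
rewrite [\prod_(1 <= i < _.+2) _]big_nat_recr //= -IHn.
by rewrite [(2 * n.+1)%N]mulnS mulrACA mulrA.
Qed.

(** Gauss's identity, truncated. *)
Lemma triangular_trunc (R : comNzRingType) n : eqXn n.+1
  ((\prod_(0 <= i < n) (1 - 'X^((2 * i).+1)))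
     * \sum_(0 <= s < n.+1) 'X^('C(s.+1, 2)) : {poly R})
  (\prod_(1 <= i < n.+1) (1 - 'X^(2 * i))).
Proof.
apply: (@eqXn_trans _ _ ((\prod_(0 <= i < n) (1 - 'X^((2 * i).+1)))
     * \sum_(0 <= s < (2 * n).+1) 'X^('C(s.+1, 2)))).
  apply: eqXnM => //; rewrite [X in eqXn _ _ X](@big_cat_nat _ _ _ n.+1) //=; last by lia.
  rewrite -[X in eqXn _ X _]addr0; apply: eqXnD => //.
  apply/eqXn_sym/eqXn_sum0 => s; rewrite mem_index_iota => /andP[ns _].
  by rewrite -['X^_]mul1r; apply: eqXn_mulXn0; rewrite bin2; nia.
rewrite -shanks_triangular [X in eqXn _ X _]big_nat_recl // mul0n mulr1.
rewrite [\prod_(0 <= i < 0) _]big_geq //.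
rewrite mulr1 -[X in eqXn _ _ X]addr0; apply: eqXnD => //.
by apply: eqXn_sum0 => s _; apply: eqXn_mulXn0; nia.
Qed.

(** Euler's pentagonal number theorem at X^2; the signs vanish in
characteristic 2. *)
Lemma pentagonal_trunc_F2 n : eqXn n.+1
  (\prod_(1 <= i < n.+1) (1 - 'X^(2 * i)) : {poly 'F_2})
  (1 + \sum_(1 <= s < n.+1)
     ('X^(s * (3 * s - 1)) + 'X^(s * (3 * s + 1)))).
Proof.
have -> : 1 + \sum_(1 <= s < n.+1) ('X^(s * (3 * s - 1)) + 'X^(s * (3 * s + 1)))
  = 1 + \sum_(1 <= s < n.+1) (-1) ^+ s * (('X^2) ^+ (s * s + 'C(s, 2))
                 + ('X^2) ^+ (s * s + 'C(s.+1, 2))) :> {poly 'F_2}.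
  congr (_ + _); apply: eq_bigr => s _.
  rewrite (oppr_pchar2 pchar2_polyF2) expr1n mul1r -!exprM.
  have bin2x2 m : (2 * 'C(m.+1, 2) = m.+1 * m)%N by rewrite -mul_bin_diag bin1.
  have e1 : (2 * (s * s + 'C(s, 2)) = s * (3 * s - 1))%N.
    by case: s => [|s] //; have := bin2x2 s; nia.
  have e2 : (2 * (s * s + 'C(s.+1, 2)) = s * (3 * s + 1))%N.
    by have := bin2x2 s; nia.
  by rewrite e1 e2.
rewrite -shanks_pentagonal [X in eqXn _ _ X]big_nat_recl // mul0n bin_small //.
rewrite !expr0 mul1r mulr1.
rewrite -[X in eqXn _ X _]addr0; apply: eqXnD.
  by under [X in eqXn _ _ X]eq_bigr do rewrite -exprM.
apply/eqXn_sym/eqXn_sum0 => s _; rewrite -exprM; apply: eqXn_mulXn0.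
have : (0 < 'C(s.+2, 2))%N by rewrite bin_gt0.
nia.
Qed.

Lemma prod_even_F2 n :
  \prod_(1 <= i < n.+1) (1 - 'X^(2 * i))
  = (\prod_(1 <= i < n.+1) (1 - 'X^i)) ^+ 2 :> {poly 'F_2}.
Proof.
rewrite -prodrXl; apply: eq_bigr => i _.
by rewrite mulnC exprM -!(pFrobenius_autE pchar2_polyF2) pFrobenius_autB_comm
  ?pFrobenius_aut1 //; exact: mulrC.
Qed.

(** Up to the truncation, f (f C) = f psi = (O E) psi = (O psi) E = E^2 = f^2 E
in the notation of the proof, and f^2 can be cancelled. *)
Lemma sum_initial_part_gf n : eqXn n.+1
  (\sum_(k < n.+1) initial_part_gf n 'F_2 k)
  (\prod_(1 <= i < n.+1) (1 - 'X^(2 * i))).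
Proof.
set C := \sum_(k < _) _; set E := \prod_(_ <= _ < _) _.
pose f : {poly 'F_2} := \prod_(1 <= i < n.+1) (1 - 'X^i).
pose O : {poly 'F_2} := \prod_(0 <= i < n) (1 - 'X^((2 * i).+1)).
pose psi : {poly 'F_2} := \sum_(0 <= s < n.+1) 'X^('C(s.+1, 2)).
have fC : eqXn n.+1 (f * C) psi.
  rewrite /psi big_mkord mulr_sumr; apply: eqXn_sum => k _.
  by apply: initial_part_gfM; rewrite -ltnS.
have f_OE : eqXn n.+1 f (O * E).
  by rewrite prod_odd_even; apply/eqXn_sym/eqXn_prod1BXn; lia.
have f0 : f`_0 = 1.
  rewrite -horner_coef0 horner_prod big_nat big1 // => i /andP[i_gt0 _].
  by rewrite !hornerE expr0n gtn_eqF ?subr0.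
do 2 apply: (eqXn_mulI f0).
apply: (@eqXn_trans _ _ (O * E * psi)); first exact: eqXnM.
rewrite mulrAC !mulrA -expr2 -prod_even_F2.
by apply: eqXnM => //; exact: triangular_trunc.
Qed.

(** * Pentagonal exponents *)

(** The numbers s(3s-1) and s(3s+1), s >= 1, are pairwise distinct, so at most
one monomial contributes to a given coefficient. *)
Lemma coef_pentagonal n :
  (\sum_(1 <= s < n.+1) ('X^(s * (3 * s - 1)) + 'X^(s * (3 * s + 1)))
     : {poly 'F_2})`_n
  = [exists s : 'I_n.+1, (0 < s)%N &&
      ((n == s * (3 * s - 1)) || (n == s * (3 * s + 1)))%N]%:R.
Proof.
pose hit s := ((n == s * (3 * s - 1)) || (n == s * (3 * s + 1)))%N.
have coef_hit s : (0 < s)%N ->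
    ('X^(s * (3 * s - 1)) + 'X^(s * (3 * s + 1)) : {poly 'F_2})`_n = (hit s)%:R.
  move=> s_gt0; rewrite coefD !coefXn -natrD /hit.
  by case: eqP => [n1|_] /=; case: eqP => // n2; nia.
rewrite coef_sum (eq_big_nat _ _ (fun s s_in => coef_hit s (proj1 (andP s_in)))).
case: existsP => [[s /andP[s_gt0 hit_s]]|no_hit].
  rewrite (bigD1_seq (val s)) ?iota_uniq ?mem_index_iota ?s_gt0 ?ltn_ord //=.
  rewrite [hit s]hit_s big_seq_cond big1 ?addr0 // => t /andP[].
  rewrite mem_index_iota => /andP[t_gt0 _] t_s.
  suff /negbTE-> : ~~ hit t by [].
  apply/negP => hit_t; case/eqP: t_s.
  by case/orP: hit_s => /eqP n_s; case/orP: hit_t => /eqP n_t; nia.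
rewrite big_nat big1 // => s /andP[s_gt0 s_n].
suff /negbTE-> : ~~ hit s by [].
by apply/negP => hit_s; apply: no_hit; exists (Ordinal s_n); rewrite s_gt0.
Qed.

(** With s = |k|, changing the sign of k exchanges k(3k+1) and k(3k-1); k = 0
is excluded by n > 0. *)
Lemma pentagonalP n : (0 < n)%N ->
  reflect (exists k : int, n%:Z = k * (3 * k + 1) \/ n%:Z = k * (3 * k - 1))
    [exists s : 'I_n.+1, (0 < s)%N &&
      ((n == s * (3 * s - 1)) || (n == s * (3 * s + 1)))%N].
Proof.
move=> n_gt0; apply: (iffP existsP) => [[s /andP[s_gt0 /orP[]/eqP n_s]]|[k n_k]].
- by exists s%:Z; right; move: s_gt0 n_s; clear; case: s => s /= _; nia.
- by exists s%:Z; left; move: n_s; clear; case: s => s /= _; nia.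
have k_n : (`|k| < n.+1)%N by nia.
exists (Ordinal k_n) => /=; apply/andP; split; first by nia.
apply/orP; have [k0|k0] : (k = `|k|%N%:Z \/ k = - `|k|%N%:Z) by lia.
- by case: n_k => n_k; [right|left]; apply/eqP; nia.
- by case: n_k => n_k; [left|right]; apply/eqP; nia.
Qed.

Close Scope ring_scope.

Theorem theorem3 (n : nat) (hn : 1 <= n) :
  ((exists k : int,
      (n%:Z = k * (3 * k + 1))%R \/ (n%:Z = k * (3 * k - 1))%R) ->
    pmex 1 1 n = 1 %[mod 2])
  /\
  (~ (exists k : int,
      (n%:Z = k * (3 * k + 1))%R \/ (n%:Z = k * (3 * k - 1))%R) ->
    pmex 1 1 n = 0 %[mod 2]).
Proof.
have pmexF : ((pmex 1 1 n)%:R = [exists s : 'I_n.+1, (0 < s)%N &&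
      ((n == s * (3 * s - 1)) || (n == s * (3 * s + 1)))%N]%:R :> 'F_2)%R.
  rewrite pmex_F2 sum_initial_part_gf // pentagonal_trunc_F2 // coefD coef1.
  by rewrite gtn_eqF // add0r coef_pentagonal.
have /(congr1 val) := pmexF; rewrite /= !val_Fp_nat // => ->.
by case: (pentagonalP hn).
Qed.
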